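(* Let $\mathcal{A}$ be a unital $C^*$-algebra and let $W\colon\mathcal{A}\otimes\mathcal{A}\to\mathcal{A}\otimes\mathcal{A}$ be a unital $C^*$-homomorphism which satisfies the pentagon equation $W_{12}W_{13}W_{23}=W_{23}W_{12}$. Define $\Delta,\widehat{\Delta}\colon\mathcal{A}\to\mathcal{A}\otimes\mathcal{A}$ by $$\Delta=W\Delta^L,\qquad \widehat{\Delta}=\Sigma W\Sigma\Delta^R,$$ where $\Delta^L(a)=a\otimes 1$, $\Delta^R(a)=1\otimes a$ for $a\in\mathcal{A}$, and $\Sigma$ is the flip on $\mathcal{A}\otimes\mathcal{A}$. Then $(\mathcal{A},\Delta)$ and $(\mathcal{A},\widehat{\Delta})$ are compact quantum semigroups.
   Context: $\mathcal{A}\otimes\mathcal{A}$ denotes the minimal $C^*$-tensor product, and a $C^*$-homomorphism is a $*$-homomorphism of $C^*$-algebras. A comultiplication on a unital $C^*$-algebra $\mathcal{A}$ is a unital $*$-homomorphism $\Delta\colon\mathcal{A}\to\mathcal{A}\otimes\mathcal{A}$ satisfying coassociativity $(\Delta\otimes \mathrm{id})\Delta=(\mathrm{id}\otimes\Delta)\Delta$; in that case $(\mathcal{A},\Delta)$ is called a compact quantum semigroup. The flip $\Sigma\colon\mathcal{A}\otimes\mathcal{A}\to\mathcal{A}\otimes\mathcal{A}$ is given by $\Sigma(a\otimes b)=b\otimes a$. For a map $V\colon\mathcal{A}\otimes\mathcal{A}\to\mathcal{A}\otimes\mathcal{A}$, the leg-numbered maps on $\mathcal{A}\otimes\mathcal{A}\otimes\mathcal{A}$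 are $V_{12}=V\otimes \mathrm{id}$, $V_{23}=\mathrm{id}\otimes V$, $V_{13}=\Sigma_{12}V_{23}\Sigma_{12}=\Sigma_{23}V_{12}\Sigma_{23}$. Products of maps are compositions. *)

(* Defs.v *)
From HB Require Import structures.
From mathcomp Require Import all_boot all_order all_algebra.
From mathcomp Require Export all_classical all_reals all_analysis.
From mathcomp Require Export complex.
Export numFieldNormedType.Exports.

Set Implicit Arguments.
Unset Strict Implicit.
Unset Printing Implicit Defensive.

Import Order.TTheory GRing.Theory Num.Theory.
Local Open Scope classical_set_scope.
Local Open Scope ring_scope.

Reserved Notation "x ** y" (at level 40, left associativity).

(* Unital C*-algebras over the complex numbers R[i].  The norm of a normed     *)
(* module over R[i] takes its values in R[i] (on the real half-line).  The     *)
(* library has no structure joining normed modules and rings, so the product   *)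
(* and the unit are part of the mixin.  The zero algebra is allowed.           *)
HB.mixin Record isUnitalCStarAlgebra (R : realType) (A : Type)
    of CompleteNormedModule R[i] A := {
  cmul : A -> A -> A ;
  cone : A ;
  cstar : A -> A ;
  cmul_linearl : forall (k : R[i]) (x y z : A),
    cmul (k *: x + y) z = k *: cmul x z + cmul y z ;
  cmul_linearr : forall (k : R[i]) (x y z : A),
    cmul x (k *: y + z) = k *: cmul x y + cmul x z ;
  cmulA : forall x y z : A, cmul x (cmul y z) = cmul (cmul x y) z ;
  cmul1l : forall x : A, cmul cone x = x ;
  cmul1r : forall x : A, cmul x cone = x ;
  cstarK : forall x : A, cstar (cstar x) = x ;
  cstar_antilinear : forall (k : R[i]) (x y : A),
    cstar (k *: x + y) = k^* *: cstar x + cstar y ;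
  cstarM : forall x y : A, cstar (cmul x y) = cmul (cstar y) (cstar x) ;
  cnormM : forall x y : A, `|cmul x y| <= `|x| * `|y| ;
  cnorm_cstar : forall x : A, `|cmul (cstar x) x| = `|x| ^+ 2
}.

#[short(type="unitalCStarType")]
HB.structure Definition UnitalCStarAlgebra (R : realType) :=
  {A of CompleteNormedModule R[i] A & isUnitalCStarAlgebra R A}.

Arguments cone {R s}.
Notation "x ** y" := (cmul x y) : ring_scope.

Definition unital_star_hom (R : realType) (A B : unitalCStarType R)
    (f : A -> B) : Prop :=
  [/\ linear f, {morph f : x y / x ** y}, f cone = cone
    & {morph f : x / cstar x}].

(* The inner product is linear in its first argument.                          *)
Record hilbert (R : realType) := Hilbert {
  hcarrier :> completeNormedModType R[i] ;
  hdot : {dot hcarrier for Num.conj} ;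
  hdot_norm : forall x, hdot x x = `|x| ^+ 2
}.

(* pi is a *-representation of A by bounded operators on H.                    *)
Definition star_representation (R : realType) (A : unitalCStarType R)
    (H : hilbert R) (pi : A -> H -> H) : Prop :=
  [/\ forall a, linear (pi a) /\ continuous (pi a),
      forall (k : R[i]) a b x, pi (k *: a + b) x = k *: pi a x + pi b x,
      forall a b x, pi (a ** b) x = pi a (pi b x)
    & forall a x y, hdot H (pi a x) y = hdot H x (pi (cstar a) y)].

(* || sum_j x_j (x) y_j ||^2 in the Hilbert space tensor product of H and K.   *)
Definition tens_sqnorm (R : realType) (H K : hilbert R) (J : finType)
    (x : J -> H) (y : J -> K) : R[i] :=
  \sum_(j : J) \sum_(j' : J) hdot H (x j) (x j') * hdot K (y j) (y j').

(* The operator norm of (pi (x) rho)(sum_i a_i (x) b_i) on the Hilbert space   *)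
(* tensor product of H and K is at most c (the vectors                         *)
(* sum_j x_j (x) y_j are dense there).                                         *)
Definition rep_bounded (R : realType) (A B : unitalCStarType R)
    (H K : hilbert R) (pi : A -> H -> H) (rho : B -> K -> K)
    (n : nat) (a : 'I_n -> A) (b : 'I_n -> B) (c : R[i]) : Prop :=
  forall (m : nat) (x : 'I_m -> H) (y : 'I_m -> K),
    tens_sqnorm (fun p : 'I_n * 'I_m => pi (a p.1) (x p.2))
                (fun p : 'I_n * 'I_m => rho (b p.1) (y p.2))
      <= c ^+ 2 * tens_sqnorm x y.

(* T, with tens a b in the role of a (x) b, is the minimal C*-tensor product   *)
(* of A and B: the completion of the algebraic tensor product *-algebra in     *)
(* the spatial norm                                                            *)
(*   ||t||_min = sup { ||(pi (x) rho)(t)|| : pi, rho *-representations }.      *)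
(* This determines (T, tens) up to a unique isomorphism.  The span of the      *)
(* a (x) b is the algebraic tensor product because ||.||_min is a norm on it.  *)
Record is_min_tensor (R : realType) (A B T : unitalCStarType R)
    (tens : A -> B -> T) : Prop := {
  tens_linearl : forall b, linear (tens^~ b) ;
  tens_linearr : forall a, linear (tens a) ;
  tensM : forall a a' b b', tens a b ** tens a' b' = tens (a ** a') (b ** b') ;
  tens_cstar : forall a b, cstar (tens a b) = tens (cstar a) (cstar b) ;
  tens_dense : closure [set t | exists (n : nat) (a : 'I_n -> A) (b : 'I_n -> B),
                                  t = \sum_(i < n) tens (a i) (b i)] = setT ;
  tens_norm : forall (n : nat) (a : 'I_n -> A) (b : 'I_n -> B) (c : R[i]),
    0 <= c ->
    (`|\sum_(i < n) tens (a i) (b i)| <= c <->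
     forall (H K : hilbert R) (pi : A -> H -> H) (rho : B -> K -> K),
       star_representation pi -> star_representation rho ->
       rep_bounded pi rho a b c)
}.

Record minTensor (R : realType) (A B : unitalCStarType R) := MinTensor {
  mtcarrier :> unitalCStarType R ;
  tens : A -> B -> mtcarrier ;
  tensP : is_min_tensor tens
}.
Arguments tens {R A B} m a b.

(* The (unique, by density) continuous linear map on T with a (x) b |-> h a b. *)
(* The default value 0 only occurs when there is no such map.                  *)
Definition tens_ext (R : realType) (A B : unitalCStarType R)
    (T : minTensor A B) (S : unitalCStarType R) (h : A -> B -> S) : T -> S :=
  xget (fun=> 0) [set F : T -> S | [/\ linear F, continuous F
                                     & forall a b, F (tens T a b) = h a b]].

(* f (x) g *)
Definition tens_map (R : realType) (A B A' B' : unitalCStarType R)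
    (T : minTensor A B) (T' : minTensor A' B') (f : A -> A') (g : B -> B') :
    T -> T' :=
  tens_ext (fun a b => tens T' (f a) (g b)).

Definition flip (R : realType) (A : unitalCStarType R) (AA : minTensor A A) :
    AA -> AA :=
  tens_ext (fun a b => tens AA b a).

Arguments tens_map {R A B A' B'} T T' f g _.
Arguments flip {R A} AA _.

(* A (x) A (x) A, that is (A (x) A) (x) A and A (x) (A (x) A) identified       *)
(* through (a (x) b) (x) c = a (x) (b (x) c): a single C*-algebra which is a   *)
(* minimal tensor product in both ways.                                        *)
Record minTensor3 (R : realType) (A : unitalCStarType R) (AA : minTensor A A) :=
  MinTensor3 {
  mt3carrier : unitalCStarType R ;
  tens3l : AA -> A -> mt3carrier ;
  tens3r : A -> AA -> mt3carrier ;
  tens3lP : is_min_tensor tens3l ;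
  tens3rP : is_min_tensor tens3r ;
  tens3A : forall a b c, tens3l (tens AA a b) c = tens3r a (tens AA b c)
}.

Section Legs.
Variables (R : realType) (A : unitalCStarType R) (AA : minTensor A A).
Variable AAA : minTensor3 AA.

Definition mt3l : minTensor AA A := MinTensor (tens3lP AAA).
Definition mt3r : minTensor A AA := MinTensor (tens3rP AAA).

Definition leg12 (V : AA -> AA) : mt3carrier AAA -> mt3carrier AAA :=
  tens_map mt3l mt3l V id.

Definition leg23 (V : AA -> AA) : mt3carrier AAA -> mt3carrier AAA :=
  tens_map mt3r mt3r id V.

Definition leg13 (V : AA -> AA) : mt3carrier AAA -> mt3carrier AAA :=
  leg12 (flip AA) \o leg23 V \o leg12 (flip AA).

Definition pentagon (W : AA -> AA) : Prop :=
  leg12 W \o leg13 W \o leg23 W = leg23 W \o leg12 W.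

Definition coassociative (Delta : A -> AA) : Prop :=
  (tens_map AA mt3l Delta id : AA -> mt3carrier AAA) \o Delta =
  (tens_map AA mt3r id Delta : AA -> mt3carrier AAA) \o Delta.

Definition compact_quantum_semigroup (Delta : A -> AA) : Prop :=
  unital_star_hom Delta /\ coassociative Delta.

End Legs.

Definition DeltaL (R : realType) (A : unitalCStarType R) (AA : minTensor A A)
  (a : A) : AA := tens AA a cone.

Definition DeltaR (R : realType) (A : unitalCStarType R) (AA : minTensor A A)
  (a : A) : AA := tens AA cone a.

(* Main.v *)
Require Import Defs.
From mathcomp Require Import all_boot.
From HB Require Import structures.
From mathcomp Require Import all_order all_algebra.
From mathcomp Require Import all_classical all_reals all_analysis complex.

(** The map [Delta a = W (a (x) 1)] is coassociative because the two sides of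
    coassociativity at [a] are the two sides of the pentagon equation at the
    element [a (x) 1 (x) 1]: one has
    [(Delta (x) id) t = W_12 Sigma_12 (1 (x) t)] and
    [(id (x) Delta) t = W_23 (t (x) 1)], and [W_23] fixes [a (x) 1 (x) 1]
    ([pentagon_coassociative]).  The second map is
    [Sigma W Sigma (1 (x) a) = Sigma W (a (x) 1)], the opposite of the first,
    and the opposite of a coassociative map is coassociative
    ([flip_coassociative]).

    What remains is to see that these formulas make sense and hold beyond
    finite sums of elementary tensors.  This needs two facts about the minimal
    tensor product, whose norm is the supremum over pairs of representations
    on Hilbert spaces.

    - If [f] and [g] are unital star-homomorphisms, then [f (x) g] exists
      ([tens_mapP]).  It is contractive on finite sums, since representations
      pull back along [f] and [g], and a contractive map with dense domain
      extends to the completion ([contractive_relation_extension]).  The same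
      argument gives the flip ([tens_swapP]).

    - The maps [t |-> a (x) t] and [t |-> t (x) b] are continuous, even when
      [t] ranges over a completed tensor product ([tens_norm_lt]).  Here one
      needs that representations are contractive, although the definition
      only asks each operator [rho t] to be bounded.  If [`|t| < c], then
      [1 - t^* t / c ^ 2] is the square of a self-adjoint element, found as the
      fixed point of a contraction ([self_adjoint_sqrt]); thus
      [c ^ 2 - (rho t)^* (rho t)] is a sum of operators [s^* s]
      ([rep_gram_defect]), and it remains positive after tensoring with the
      identity of another Hilbert space, by the Schur product theorem
      ([gram_product_ge0]). *)

Set Implicit Arguments.
Unset Strict Implicit.
Unset Printing Implicit Defensive.

Import Order.TTheory GRing.Theory Num.Theory.
Local Open Scope classical_set_scope.
Local Open Scope ring_scope.

(** * Completeness and extension by continuity *)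

Lemma continuous_compose (X Y Z : topologicalType)
    (f : X -> Y) (g : Y -> Z) :
  continuous f -> continuous g -> continuous (g \o f).
Proof. by move=> cf cg x; apply: continuous_comp; [exact: cf|exact: cg]. Qed.

Section Banach.
Context {K : numFieldType}.

(** Solving a problem in a complete space only requires solving it
    approximately, if solutions with a small error [e] (the members of [S e])
    are close to each other.  The sets [S e] form a Cauchy filter base. *)
Lemma approximation_limit (X : completeNormedModType K) (S : K -> set X) :
  (forall e, 0 < e -> S e !=set0) ->
  (forall d e, d <= e -> S d `<=` S e) ->
  (forall e, 0 < e -> exists2 d, 0 < d &
     forall x y, S d x -> S d y -> `|x - y| < e) ->
  exists p, forall e, 0 < e -> exists2 x, S e x & `|p - x| < e.
Proof.
move=> S0 Sle Ssmall; pose F := filter_from [set e : K | 0 < e] S.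
have SF e : 0 < e -> F (S e) by exists e.
have minP (d e : K) : 0 < d -> 0 < e -> exists m, [/\ 0 < m, m <= d & m <= e].
  move=> d0 e0.
  have /orP[de|ed] := real_leVge (gtr0_real d0) (gtr0_real e0).
    by exists d; split.
  by exists e; split.
have FF : ProperFilter F.
  apply: filter_from_proper; last exact: S0.
  apply: filter_from_filter; first by exists 1; exact: ltr01.
  move=> d e d0 e0; have [m [m0 md me]] := minP _ _ d0 e0.
  by exists m => // x Sx; split; apply: Sle Sx.
have cF : cauchy F.
  apply: cauchy_exP => e e0; have [d d0 small] := Ssmall _ e0.
  have [x Sx] := S0 _ d0; exists x; apply: filterS (SF _ d0) => y Sy.
  by rewrite -ball_normE; exact: small.
have Fp := cauchy_cvg F cF; exists (lim F) => e e0.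
set p := lim F in Fp *.
have Fe : F [set x | `|p - x| < e].
  by apply: Fp; rewrite -nbhs_nbhs_norm; exists e.
by have [x [/= px Sx]] := filter_ex (filterI Fe (SF _ e0)); exists x.
Qed.

Lemma linear_lipschitz_continuous (X Y : normedModType K) (f : X -> Y) (k : K) :
  0 <= k -> linear f -> (forall x, `|f x| <= k * `|x|) -> continuous f.
Proof.
move=> k0 linf fk.
pose f' : {linear X -> Y} :=
  HB.pack f (GRing.isLinear.Build K X Y *:%R f linf).
apply: (@bounded_linear_continuous K X Y f'); apply/bounded_funP => r.
by exists (k * r) => x xr; apply: le_trans (fk x) _; rewrite ler_wpM2l.
Qed.

Lemma dense_continuous_eq (X Y : normedModType K) (f g : X -> Y) (D : set X) :
  continuous f -> continuous g -> closure D = setT ->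
  (forall x, D x -> f x = g x) -> f = g.
Proof.
move=> cf cg dD fg; apply/funext => x; apply/subr0_eq.
have cl : closed [set y | f y - g y = 0].
  apply: (@preimage_closed X Y (fun y => f y - g y) [set 0]) => [y _|].
    by apply: cvgB; [exact: cf|exact: cg].
  exact/accessible_closed_set1/hausdorff_accessible/norm_hausdorff.
have /(_ x) : closure D `<=` [set y | f y - g y = 0].
  rewrite [X in _ `<=` X](proj1 (closure_id _) cl); apply: closureS => y Dy /=.
  by rewrite fg// subrr.
by rewrite dD => /(_ I).
Qed.

(** Extension by continuity, for a map that is given on a dense subspace by
    non-unique expressions (such as finite sums of elementary tensors).  The
    map is presented by its graph [G], so that well-definedness is part of the
    contraction bound: the second components of two pairs in [G] with the same
    first component differ by the image of 0.  The extension is the closure of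
    [G]; every point has an image in it because the target is complete. *)
Lemma contractive_relation_extension (X : normedModType K)
    (Y : completeNormedModType K) (G : X -> Y -> Prop) :
  (forall k x y x' y', G x y -> G x' y' -> G (k *: x + x') (k *: y + y')) ->
  (forall x y, G x y -> `|y| <= `|x|) ->
  closure [set x | exists y, G x y] = setT ->
  exists F : X -> Y, [/\ linear F, continuous F & forall x y, G x y -> F x = y].
Proof.
move=> Glin Gle Gdense.
have GB x y x' y' : G x y -> G x' y' -> G (x - x') (y - y').
  move=> Gxy Gxy'; have := Glin (- 1) _ _ _ _ Gxy' Gxy.
  by rewrite !scaleN1r ![- _ + _]addrC.
pose P x y := forall e, 0 < e ->
  exists x' y', [/\ G x' y', `|x - x'| < e & `|y - y'| < e].
have GP x y : G x y -> P x y.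
  by move=> Gxy e e0; exists x, y; rewrite !subrr !normr0.
have Ple x y : P x y -> `|y| <= `|x|.
  move=> Pxy; apply/ler_addgt0Pr => e e0.
  have [x' [y' [Gxy xx' yy']]] := Pxy _ (divr_gt0 e0 (ltr0Sn K 1)).
  rewrite -(subrK y' y) (le_trans (ler_normD _ _))//.
  rewrite (splitr e) addrA addrC lerD// ?(ltW yy')//.
  rewrite (le_trans (Gle _ _ Gxy))// -{1}(subrK x x').
  rewrite (le_trans (ler_normD _ _))//.
  by rewrite [leRHS]addrC lerD2r distrC ltW.
have Plin k x y x' y' : P x y -> P x' y' -> P (k *: x + x') (k *: y + y').
  move=> Pxy Pxy' e e0; pose d := e / (`|k| + 1).
  have k0 : 0 < `|k| + 1 by rewrite ltr_wpDl.
  have d0 : 0 < d by rewrite divr_gt0.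
  have [u [v [Guv xu yv]]] := Pxy _ d0.
  have [u' [v' [Guv' xu' yv']]] := Pxy' _ d0.
  exists (k *: u + u'), (k *: v + v'); split; first exact: Glin.
    rewrite opprD addrACA -scalerBr (le_lt_trans (ler_normD _ _))//.
    rewrite normrZ (_ : e = `|k| * d + d); last first.
      by rewrite -[X in _ + X]mul1r -mulrDl mulrC divfK// gt_eqF.
    by rewrite ler_ltD// ler_wpM2l// ltW.
  rewrite opprD addrACA -scalerBr (le_lt_trans (ler_normD _ _))//.
  rewrite normrZ (_ : e = `|k| * d + d); last first.
    by rewrite -[X in _ + X]mul1r -mulrDl mulrC divfK// gt_eqF.
  by rewrite ler_ltD// ler_wpM2l// ltW.
have Pex x : exists y, P x y.
  pose S e := [set y | exists2 x', G x' y & `|x - x'| < e].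
  have [e e0|d e de y [x' Gx' xx']|e e0|y Sy] := @approximation_limit Y S.
  - have : closure [set x | exists y, G x y] x by rewrite Gdense.
    move=> /(_ [set z | `|x - z| < e])[].
      by rewrite -nbhs_nbhs_norm; exists e.
    by move=> z [[y Gzy] xz]; exists y, z.
  - by exists x' => //; apply: lt_le_trans xx' de.
  - exists (e / 2); first by rewrite divr_gt0.
    move=> y y' [z Gz xz] [z' Gz' xz'].
    rewrite (le_lt_trans (Gle _ _ (GB _ _ _ _ Gz Gz')))//.
    rewrite -(subrK x z) -addrA (le_lt_trans (ler_normD _ _))// (splitr e).
    by rewrite ltrD// distrC.
  - exists y => e e0; have [y' [x' Gx' xx'] yy'] := Sy _ e0.
    by exists x', y'.
pose F x := sval (cid (Pex x)).
have PF x : P x (F x) by rewrite /F; case: cid.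
have Puniq x y : P x y -> F x = y.
  move=> Pxy; apply/subr0_eq/normr0_eq0/le_anti; rewrite normr_ge0 andbT.
  have := Plin (- 1) _ _ _ _ Pxy (PF x).
  by rewrite !scaleN1r addNr => /Ple; rewrite normr0 addrC.
have linF : linear F by move=> k x x'; apply: Puniq; exact: Plin.
exists F; split=> // [|x y Gxy]; last exact/Puniq/GP.
apply: (@linear_lipschitz_continuous _ _ F 1) => // x.
by rewrite mul1r; exact: Ple.
Qed.

End Banach.

(** * Elementary properties of linear maps and C*-algebras *)

Section LinearMaps.
Context {K : nzRingType} {U V : lmodType K} {f : U -> V} (linf : linear f).

Let f' : {linear U -> V} := HB.pack f (GRing.isLinear.Build K U V *:%R f linf).

Lemma linear_zero : f 0 = 0. Proof. exact: (raddf0 f'). Qed.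
Lemma linear_sub x y : f (x - y) = f x - f y. Proof. exact: (raddfB f'). Qed.
Lemma linear_scale k x : f (k *: x) = k *: f x.
Proof. exact: (linearZ_LR f'). Qed.
Lemma linear_bigsum I (r : seq I) (E : I -> U) :
  f (\sum_(i <- r) E i) = \sum_(i <- r) f (E i).
Proof. exact: (raddf_sum f'). Qed.

End LinearMaps.

Section CStarBasics.
Context {R : realType} {A : unitalCStarType R}.
Implicit Types x y z : A.

Lemma cmul_linear_l z : linear (fun x : A => x ** z).
Proof. by move=> k x y; exact: cmul_linearl. Qed.
Lemma cmul_linear_r z : linear (cmul z).
Proof. by move=> k x y; exact: cmul_linearr. Qed.

Definition cmulBl z := linear_sub (cmul_linear_l z).
Definition cmulBr z := linear_sub (cmul_linear_r z).
Definition cmulZl z := linear_scale (cmul_linear_l z).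
Definition cmulZr z := linear_scale (cmul_linear_r z).

Lemma cmul_continuous_l z : continuous (fun x : A => x ** z).
Proof.
apply: (@linear_lipschitz_continuous _ _ _ _ `|z|) (cmul_linear_l z) _ => // x.
by rewrite mulrC; exact: cnormM.
Qed.

Lemma cmul_continuous_r z : continuous (cmul z).
Proof.
apply: (@linear_lipschitz_continuous _ _ _ _ `|z|) (cmul_linear_r z) _ => // x.
exact: cnormM.
Qed.

Lemma cstarD x y : cstar (x + y) = cstar x + cstar y.
Proof. by have := cstar_antilinear 1 x y; rewrite conjC1 !scale1r. Qed.

Lemma cstar0 : cstar (0 : A) = 0.
Proof. by apply: (addrI (cstar 0)); rewrite -cstarD !addr0. Qed.

Lemma cstarZ k x : cstar (k *: x) = k^* *: cstar x.
Proof. by have := cstar_antilinear k x 0; rewrite cstar0 !addr0. Qed.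

Lemma cstarB x y : cstar (x - y) = cstar x - cstar y.
Proof. by rewrite -scaleN1r cstarD cstarZ rmorphN1 scaleN1r. Qed.

Lemma cstar1 : cstar (cone : A) = cone.
Proof. by rewrite -[LHS]cmul1l -{1}[cone]cstarK -cstarM cmul1l cstarK. Qed.

Lemma norm_cstar x : `|cstar x| = `|x|.
Proof.
have le y : `|y| <= `|cstar y|.
  have [->|y0] := eqVneq y 0; first by rewrite normr0.
  have := cnormM (cstar y) y.
  by rewrite cnorm_cstar expr2 ler_pM2r ?normr_gt0.
by apply: le_anti; rewrite le andbT -{2}[x]cstarK le.
Qed.

End CStarBasics.

Arguments cmul_continuous_l {R A} z _ _ _.
Arguments cmul_continuous_r {R A} z _ _ _.

(** * Square roots in C*-algebras *)

Section SquareRoot.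
Context {R : realType}.

(** Norms take their values in the real elements of [R[i]], where the
    archimedean property is inherited from [R]. *)
Lemma expr_lt_eventually (q e : R[i]) :
  0 <= q -> q < 1 -> 0 < e -> exists n, q ^+ n < e.
Proof.
move=> q0 q1 e0.
have /complex_realP[q' qE] := ger0_real q0.
have /complex_realP[e' eE] := gtr0_real e0.
move: q0 q1 e0; rewrite qE eE.
rewrite -(rmorph0 (real_complex R)) -(rmorph1 (real_complex R)).
rewrite lecR !ltcR => q0 q1 e0.
have /cvgrPdist_lt /(_ e' e0) [n _ /(_ n (leqnn n))] :
    (GRing.exp q' : R^nat) @ \oo --> (0 : R).
  by apply: cvg_expr; rewrite ger0_norm.
rewrite /= sub0r normrN ger0_norm ?exprn_ge0// => qn.
by exists n; rewrite -rmorphXn ltcR.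
Qed.

(** The contraction principle.  The iterates are almost fixed, and almost fixed
    points are close to each other, so [approximation_limit] applies. *)
Lemma contraction_fixed_point (X : completeNormedModType R[i]) (U : set X)
    (g : X -> X) (q : R[i]) :
  closed U -> (forall x, U x -> U (g x)) -> 0 <= q -> q < 1 ->
  (forall x y, U x -> U y -> `|g x - g y| <= q * `|x - y|) ->
  U !=set0 -> exists2 p, U p & g p = p.
Proof.
move=> cU gU q0 q1 gq [x0 Ux0].
have q1' : 0 < 1 - q by rewrite subr_gt0.
pose S e := [set x | U x /\ `|g x - x| <= e].
have [e e0|d e de x [Ux xd]|e e0|p Sp] := @approximation_limit _ X S.
- have Un n : U (iter n g x0) by elim: n => //= n; exact: gU.
  have dn n : `|g (iter n g x0) - iter n g x0| <= q ^+ n * `|g x0 - x0|.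
    elim: n => [|n ih]; first by rewrite mul1r.
    by rewrite /= (le_trans (gq _ _ (Un n.+1) (Un n)))// exprS -mulrA ler_wpM2l.
  have k0 : 0 < `|g x0 - x0| + 1 by rewrite ltr_wpDl.
  have [n qn] := expr_lt_eventually q0 q1 (divr_gt0 e0 k0).
  exists (iter n g x0); split=> //; rewrite (le_trans (dn n))//.
  rewrite (le_trans (ler_wpM2r _ (ltW qn)))//.
  by rewrite mulrAC ler_pdivrMr// ler_wpM2l ?(ltW e0)// lerDl.
- by split=> //; apply: le_trans xd de.
- exists (e * (1 - q) / 4); first by rewrite !mulr_gt0// invr_gt0.
  move=> x y [Ux xd] [Uy yd].
  have : `|x - y| <= e * (1 - q) / 4 + q * `|x - y| + e * (1 - q) / 4.
    rewrite {1}(_ : x - y = (x - g x) + (g x - g y) + (g y - y)); last first.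
      by rewrite !addrA !subrK.
    rewrite (le_trans (ler_normD _ _))// lerD//.
    by rewrite (le_trans (ler_normD _ _))// lerD ?gq// distrC.
  rewrite addrAC -mulrDl -lerBlDr -[X in X - _]mul1r -mulrBl mulrC.
  rewrite -ler_pdivlMr// => /le_lt_trans; apply.
  rewrite !ltr_pdivrMr// -mulr2n -[_ *+ 2]mulr_natr.
  by rewrite ltr_pM2l ?ltr_nat// mulr_gt0.
- have Up : U p.
    rewrite (proj1 (closure_id _) cU) => B.
    rewrite -nbhs_nbhs_norm => -[e /= e0 Be].
    by have [x [Ux _] px] := Sp _ e0; exists x; split=> //; exact: Be.
  exists p => //; apply/subr0_eq/normr0_eq0/le_anti; rewrite normr_ge0 andbT.
  apply/ler_addgt0Pr => e e0; rewrite add0r.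
  have e30 : 0 < e / 3 by rewrite divr_gt0.
  have [x [Ux xe] px] := Sp _ e30.
  have -> : g p - p = (g p - g x) + (g x - x) + (x - p).
    by rewrite !addrA !subrK.
  have -> : e = e / 3 + e / 3 + e / 3.
    by rewrite -!mulrDl -mulr2n -mulrSr -[e *+ 3]mulr_natr mulfK.
  rewrite (le_trans (ler_normD _ _))// lerD//; last by rewrite distrC ltW.
  rewrite (le_trans (ler_normD _ _))// lerD//.
  rewrite (le_trans (gq _ _ Up Ux))// (le_trans _ (ltW px))//.
  by rewrite ler_piMl// ltW.
Qed.

(** If [z = 1 - y], then [z ** z = 1 - h] says that [y] is a fixed point of
    [g y = (h + y ** y) / 2], which contracts the ball of radius [`|h|].  The
    map [g] commutes with the involution, so the unique fixed point in the ball
    is self-adjoint. *)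
Lemma self_adjoint_sqrt (A : unitalCStarType R) (h : A) :
  cstar h = h -> `|h| < 1 ->
  exists2 z : A, cstar z = z & z ** z = cone - h.
Proof.
move=> hh h1; pose g (y : A) := 2^-1 *: (h + y ** y).
pose U := [set y : A | `|y| <= `|h|].
have half0 : 0 < 2^-1 :> R[i] by rewrite invr_gt0.
have gU y : U y -> U (g y).
  rewrite /U/= => yh; rewrite normrZ gtr0_norm// ler_pdivrMl//.
  rewrite (le_trans (ler_normD _ _))// -[2]natr1 mulrDl mul1r lerD2l.
  rewrite (le_trans (cnormM _ _))// (le_trans (ler_pM _ _ yh yh))//.
  by rewrite ler_piMl// ltW.
have gq x y : U x -> U y -> `|g x - g y| <= `|h| * `|x - y|.
  rewrite /U/= => xh yh; rewrite -scalerBr normrZ gtr0_norm// ler_pdivrMl//.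
  rewrite opprD addrACA subrr add0r.
  (* This form of the difference of two squares needs no commutation. *)
  have -> : x ** x - y ** y = x ** (x - y) + (x - y) ** y.
    by rewrite cmulBr cmulBl addrA subrK.
  rewrite (le_trans (ler_normD _ _))// -[2]natr1 mulrDl mul1r.
  rewrite lerD// (le_trans (cnormM _ _))// ?ler_wpM2r//.
  by rewrite mulrC ler_wpM2r.
have cU : closed U.
  move=> p; rewrite /U/= => clp; apply/ler_addgt0Pr => e e0.
  have [|x [xh px]] := clp [set x | `|p - x| < e].
    by rewrite -nbhs_nbhs_norm; exists e.
  rewrite -(subrK x p) addrC (le_trans (ler_normD _ _))//.
  by rewrite lerD// ltW.
have [|y Uy gy] := contraction_fixed_point cU gU (normr_ge0 h) h1 gq.
  by exists 0; rewrite /U/= normr0.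
have gs x : cstar (g x) = g (cstar x).
  rewrite /g cstarZ cstarD hh cstarM; congr (_ *: _).
  by rewrite conj_Creal// ger0_real// ltW.
have sy : cstar y = y.
  have Usy : U (cstar y) by rewrite /U/= norm_cstar.
  have gsy : g (cstar y) = cstar y by rewrite -gs gy.
  apply/subr0_eq; have := gq _ _ Usy Uy; rewrite gsy gy => le.
  apply/eqP; apply: contraTT h1; rewrite -normr_gt0 => d0.
  rewrite -real_leNgt ?normr_real ?real1//.
  by rewrite -(ler_pM2r d0) mul1r.
exists (cone - y); first by rewrite cstarB cstar1 sy.
have -> : h = y + y - y ** y.
  rewrite -mulr2n -scaler_nat -{1}gy scalerA divff ?pnatr_eq0//.
  by rewrite scale1r addrK.
by rewrite cmulBl !cmulBr !cmul1l cmul1r !opprD !opprK !addrA.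
Qed.

End SquareRoot.

(** * Positivity and representations on Hilbert spaces *)

Section HilbertDot.
Context {R : realType} {H : hilbert R}.
Implicit Types x y z : H.

Lemma hdotC x y : hdot H x y = (hdot H y x)^*.
Proof. by have := hermC (hdot H) x y; rewrite expr0 mul1r. Qed.
Lemma hdotBl x y z : hdot H (x - y) z = hdot H x z - hdot H y z.
Proof. exact: linearBl. Qed.
Lemma hdotBr x y z : hdot H z (x - y) = hdot H z x - hdot H z y.
Proof. exact: linearBr. Qed.
Lemma hdotZl k x y : hdot H (k *: x) y = k * hdot H x y.
Proof. exact: linearZl_LR. Qed.
Lemma hdotZr k x y : hdot H x (k *: y) = k^* * hdot H x y.
Proof. exact: linearZr_LR. Qed.
Lemma hdot0l x : hdot H 0 x = 0.
Proof. exact: linear0l. Qed.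
Lemma hdot_suml I (r : seq I) (F : I -> H) x :
  hdot H (\sum_(i <- r) F i) x = \sum_(i <- r) hdot H (F i) x.
Proof. exact: linear_sumlz. Qed.
Lemma hdot_sumr I (r : seq I) (F : I -> H) x :
  hdot H x (\sum_(i <- r) F i) = \sum_(i <- r) hdot H x (F i).
Proof. exact: linear_sumr. Qed.
Lemma hdot_ge0 x : 0 <= hdot H x x.
Proof. by rewrite hdot_norm exprn_ge0. Qed.
End HilbertDot.

Section HilbertTensor.
Context {R : realType} {H K : hilbert R}.

(** The Schur product theorem: the entrywise product of two Gram matrices is
    positive semidefinite.  One Gram-Schmidt step splits the first matrix into
    a rank-one part along [x j0], which contributes the squared norm of a
    combination of the [y j], and the Gram matrix of vectors [x' j] orthogonal
    to [x j0], where the index [j0] has dropped out. *)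
Lemma gram_product_ge0 (J : eqType) (s : seq J) (x : J -> H) (y : J -> K) :
  0 <= \sum_(i <- s) \sum_(j <- s) hdot H (x i) (x j) * hdot K (y i) (y j).
Proof.
elim: s x => [|j0 s ih] x; first by rewrite big_nil.
(* When x j0 = 0, division by zero gives c j = 0, as it should. *)
pose e := x j0; pose n := hdot H e e; pose c j := hdot H (x j) e / n.
pose x' j := x j - c j *: e.
have ce j : hdot H (x j) e = c j * n.
  rewrite /c /n hdot_norm; have [->|e0] := eqVneq e 0.
    by rewrite hdotC hdot0l rmorph0 !mul0r.
  by rewrite divfK// expf_neq0// normr_eq0.
have n_real : n^* = n by rewrite conj_Creal// ger0_real// hdot_ge0.
have split_dot i j :
    hdot H (x i) (x j) = c i * (c j)^* * n + hdot H (x' i) (x' j).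
  rewrite /x' hdotBl !hdotBr !hdotZl !hdotZr -/n.
  rewrite [hdot H e (x j)]hdotC !ce (rmorphM _ (c j) n)/= n_real.
  by rewrite subrr subr0 mulrCA mulrA [RHS]addrC subrK.
have x'j0 : x' j0 = 0.
  rewrite /x' -/e; have [->|e0] := eqVneq e 0; first by rewrite scaler0 subr0.
  by rewrite /c divff ?scale1r ?subrr// /n hdot_norm expf_neq0// normr_eq0.
under eq_bigr do under eq_bigr do rewrite split_dot mulrDl.
under eq_bigr do rewrite big_split.
rewrite big_split/= addr_ge0//.
  pose v := \sum_(j <- j0 :: s) c j *: y j.
  have -> : \sum_(i <- j0 :: s) \sum_(j <- j0 :: s)
              c i * (c j)^* * n * hdot K (y i) (y j) = n * hdot K v v.
    rewrite hdot_suml mulr_sumr; apply: eq_bigr => i _.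
    rewrite hdot_sumr mulr_sumr; apply: eq_bigr => j _.
    by rewrite hdotZl hdotZr [RHS]mulrCA -!mulrA [_ * (n * _)]mulrCA.
  by rewrite mulr_ge0 ?hdot_ge0.
rewrite big_cons big1 ?add0r; last by move=> j _; rewrite x'j0 hdot0l mul0r.
under eq_bigr do rewrite big_cons x'j0 hdotC hdot0l rmorph0 mul0r add0r.
exact: ih.
Qed.

Lemma tens_sqnorm_ge0 (J : finType) (x : J -> H) (y : J -> K) :
  0 <= tens_sqnorm x y.
Proof. exact: gram_product_ge0. Qed.

Lemma tens_sqnormC (J : finType) (x : J -> H) (y : J -> K) :
  tens_sqnorm x y = tens_sqnorm y x.
Proof. by apply: eq_bigr => i _; apply: eq_bigr => j _; rewrite mulrC. Qed.

End HilbertTensor.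

Section Representations.
Context {R : realType} {A : unitalCStarType R} {H : hilbert R}.
Context {rho : A -> H -> H} (rep : star_representation rho).

Lemma rep_linear v : linear (fun a => rho a v).
Proof. by case: rep => _ repl _ _ k a b; exact: repl. Qed.

Lemma rep_dot a b v w :
  hdot H (rho a v) (rho b w) = hdot H v (rho (cstar a ** b) w).
Proof. by case: rep => _ _ repM reps; rewrite reps repM. Qed.

(** The operator [c ^+ 2 - (rho t)^* (rho t)] is positive, in the strong form
    that it is a sum of operators [s^* s]: on the range of the projection
    [rho cone] it is the image of the square of [c] times a self-adjoint square
    root of [1 - t^* t / c ^+ 2]; on the complement, where [rho] vanishes, it
    is multiplication by [c ^+ 2]. *)
Lemma rep_gram_defect (t : A) (c : R[i]) :
  `|t| < c -> exists z : A, forall v w,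
    c ^+ 2 * hdot H v w - hdot H (rho t v) (rho t w) =
    hdot H (rho z v) (rho z w) +
    c ^+ 2 * hdot H (v - rho cone v) (w - rho cone w).
Proof.
move=> tc; have c0 : 0 < c by apply: le_lt_trans tc.
have c_real : c^* = c by rewrite conj_Creal// gtr0_real.
pose h := c ^- 2 *: (cstar t ** t).
have c2_real : (c ^- 2)^* = c ^- 2 by rewrite fmorphV rmorphXn/= c_real.
have [||z zs zz] := self_adjoint_sqrt (h := h).
- by rewrite /h cstarZ cstarM cstarK c2_real.
- rewrite normrZ cnorm_cstar gtr0_norm ?invr_gt0 ?exprn_gt0//.
  by rewrite mulrC ltr_pdivrMr ?exprn_gt0// mul1r ltr_pXn2r// nnegrE// ltW.
exists (c *: z) => v w.
have one_dot : hdot H (rho cone v) (rho cone w) = hdot H v (rho cone w).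
  by rewrite rep_dot cstar1 cmul1l.
have one_dot' : hdot H (rho cone v) w = hdot H v (rho cone w).
  by rewrite [LHS]hdotC -{1}cstar1; case: rep => _ _ _ <-; rewrite -hdotC.
rewrite !rep_dot cstarZ cmulZl cmulZr scalerA zs zz c_real.
rewrite scalerBr /h scalerA -expr2 divff ?expf_neq0 ?gt_eqF// scale1r.
rewrite (linear_sub (rep_linear w)) (linear_scale (rep_linear w)).
rewrite !hdotBl !hdotBr hdotZr one_dot one_dot' subrr subr0 rmorphXn/= c_real.
by rewrite mulrBr [RHS]addrC -addrA; congr (_ + _); rewrite addrA addNr add0r.
Qed.

End Representations.

(** The operator [1 (x) rho t] on the Hilbert space tensor product has norm at
    most [c].  The positive operator of [rep_gram_defect] turns the defect of
    this inequality into two nonnegative [tens_sqnorm]. *)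
Lemma tens_sqnorm_rep (R : realType) (A : unitalCStarType R) (H K : hilbert R)
    (rho : A -> K -> K) (J : finType) (x : J -> H) (y : J -> K) (t : A)
    (c : R[i]) :
  star_representation rho -> `|t| < c ->
  tens_sqnorm x (fun j => rho t (y j)) <= c ^+ 2 * tens_sqnorm x y.
Proof.
move=> rep tc; have [z zE] := rep_gram_defect rep tc.
have c0 : 0 < c by apply: le_lt_trans tc.
rewrite -subr_ge0.
have -> : c ^+ 2 * tens_sqnorm x y - tens_sqnorm x (fun j => rho t (y j)) =
    tens_sqnorm x (fun j => rho z (y j)) +
    c ^+ 2 * tens_sqnorm x (fun j => y j - rho cone (y j)).
  rewrite /tens_sqnorm !mulr_sumr -sumrB -big_split; apply: eq_bigr => i _ /=.
  rewrite !mulr_sumr -sumrB -big_split; apply: eq_bigr => j _ /=.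
  by rewrite mulrCA -mulrBr zE mulrDr [in RHS]mulrCA.
by rewrite addr_ge0 ?mulr_ge0 ?tens_sqnorm_ge0 ?exprn_ge0 ?ltW.
Qed.

(** * The minimal tensor product *)

Lemma tens_sqnorm_snd (R : realType) (H K : hilbert R) (m : nat)
    (x : 'I_m -> H) (y : 'I_m -> K) :
  tens_sqnorm (fun p : 'I_1 * 'I_m => x p.2) (fun p => y p.2) =
  tens_sqnorm x y.
Proof.
have sum_snd (F : 'I_m -> R[i]) : \sum_(p : 'I_1 * 'I_m) F p.2 = \sum_j F j.
  by rewrite -(pair_bigA _ (fun _ j => F j)) big_ord1.
pose G i j := hdot H (x i) (x j) * hdot K (y i) (y j).
rewrite /tens_sqnorm (sum_snd (fun i => \sum_(q : 'I_1 * 'I_m) G i q.2)).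
by apply: eq_bigr => i _; exact: sum_snd.
Qed.

Section TensorProduct.
Context {R : realType} {A B : unitalCStarType R} (T : minTensor A B).

(** The cross norm inequality.  The minimal norm is defined by representations,
    so it rests on the contractivity of every representation, in the form of
    [tens_sqnorm_rep], used once in each factor. *)
Lemma tens_norm_lt (a : A) (b : B) (c d : R[i]) :
  `|a| < c -> `|b| < d -> `|tens T a b| <= c * d.
Proof.
move=> ac bd.
have c0 : 0 <= c by apply/ltW/(le_lt_trans _ ac).
have d0 : 0 <= d by apply/ltW/(le_lt_trans _ bd).
have := tens_norm (tensP T) (fun _ : 'I_1 => a) (fun _ => b) (mulr_ge0 c0 d0).
rewrite big_ord1 => -[_]; apply=> H K pi rho pirep rhorep m x y.
rewrite (tens_sqnorm_snd (fun j => pi a (x j)) (fun j => rho b (y j))).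
rewrite (le_trans (tens_sqnorm_rep _ _ rhorep bd))//.
rewrite exprMn [c ^+ 2 * _]mulrC -[leRHS]mulrA.
rewrite ler_wpM2l ?exprn_ge0// tens_sqnormC [X in _ * X]tens_sqnormC.
exact: tens_sqnorm_rep.
Qed.

Lemma tens_continuous_r (a : A) : continuous (tens T a).
Proof.
have lin := tens_linearr (tensP T) a.
pose k := `|a| + 1.
have k0 : 0 <= k by rewrite addr_ge0.
apply: (linear_lipschitz_continuous k0 lin) => b.
have [->|b0] := eqVneq b 0; first by rewrite (linear_zero lin) !normr0 mulr0.
apply/ler_addgt0Pr => e e0.
have ka : `|a| < k by rewrite ltrDl.
have k1 : 0 < k by apply: le_lt_trans ka.
have be : `|b| < `|b| + e / k by rewrite ltrDl divr_gt0.
by have := tens_norm_lt ka be; rewrite mulrDr mulrCA divff ?mulr1// gt_eqF.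
Qed.

Lemma tens_continuous_l (b : B) : continuous (tens T ^~ b).
Proof.
have lin := tens_linearl (tensP T) b.
pose k := `|b| + 1.
have k0 : 0 <= k by rewrite addr_ge0.
apply: (linear_lipschitz_continuous k0 lin) => a.
apply/ler_addgt0Pr => e e0.
have kb : `|b| < k by rewrite ltrDl.
have k1 : 0 < k by apply: le_lt_trans kb.
have ae : `|a| < `|a| + e / k by rewrite ltrDl divr_gt0.
by have := tens_norm_lt ae kb; rewrite mulrDl divfK ?gt_eqF// mulrC.
Qed.

Lemma elementary_tens_eq (Y : normedModType R[i]) (f g : T -> Y) :
  linear f -> continuous f -> linear g -> continuous g ->
  (forall a b, f (tens T a b) = g (tens T a b)) -> f = g.
Proof.
move=> lf cf lg cg fg.
apply: dense_continuous_eq cf cg (tens_dense (tensP T)) _.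
move=> _ [n [a [b ->]]]; rewrite (linear_bigsum lf) (linear_bigsum lg).
by apply: eq_bigr => i _.
Qed.

(** [tens cone cone] is neutral for elementary tensors, hence for all elements
    by density, and a neutral element is unique. *)
Lemma tens1 : tens T cone cone = cone.
Proof.
have : cmul (tens T cone cone) = id.
  apply: elementary_tens_eq => //.
  - exact: cmul_linear_r.
  - exact: cmul_continuous_r.
  - by move=> x; exact: cvg_id.
  by move=> a b; rewrite (tensM (tensP T)) !cmul1l.
by move=> /(congr1 (@^~ cone)); rewrite cmul1r.
Qed.

(** A contraction bound on finite sums makes [h] well defined and continuous
    on the algebraic tensor product, hence [tens_ext h] is not the default. *)
Lemma tens_extP (S : unitalCStarType R) (h : A -> B -> S) :
  (forall b, linear (h^~ b)) ->
  (forall n (a : 'I_n -> A) (b : 'I_n -> B),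
     `|\sum_(i < n) h (a i) (b i)| <= `|\sum_(i < n) tens T (a i) (b i)|) ->
  [/\ linear (tens_ext h : T -> S), continuous (tens_ext h : T -> S)
    & forall a b, (tens_ext h : T -> S) (tens T a b) = h a b].
Proof.
move=> hl hle; rewrite /tens_ext.
case: xgetP => // /(_ _) noF.
pose G (t : T) (s : S) := exists n (a : 'I_n -> A) (b : 'I_n -> B),
  t = \sum_(i < n) tens T (a i) (b i) /\ s = \sum_(i < n) h (a i) (b i).
have [k t s t' s' [n [a [b [-> ->]]]] [m [a' [b' [-> ->]]]]|t s||
      F [linF contF FG]]
  := @contractive_relation_extension _ T S G.
- pose a2 (i : 'I_(n + m)) :=
    match fintype.split i with inl j => k *: a j | inr j => a' j end.
  pose b2 (i : 'I_(n + m)) :=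
    match fintype.split i with inl j => b j | inr j => b' j end.
  exists (n + m)%N, a2, b2; rewrite !big_split_ord/=.
  have a2l i : a2 (lshift m i) = k *: a i by rewrite /a2 (unsplitK (inl i)).
  have b2l i : b2 (lshift m i) = b i by rewrite /b2 (unsplitK (inl i)).
  have a2r i : a2 (rshift n i) = a' i by rewrite /a2 (unsplitK (inr i)).
  have b2r i : b2 (rshift n i) = b' i by rewrite /b2 (unsplitK (inr i)).
  split; rewrite scaler_sumr; congr (_ + _); apply: eq_bigr => i _;
    rewrite ?a2l ?b2l ?a2r ?b2r//.
    by rewrite (linear_scale (tens_linearl (tensP T) _)).
  by rewrite (linear_scale (hl _)).
- by move=> [n [a [b [-> ->]]]]; exact: hle.
- rewrite -(tens_dense (tensP T)); congr closure; apply/seteqP; split=> t.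
    by move=> [s [n [a [b [-> _]]]]]; exists n, a, b.
  by move=> [n [a [b ->]]]; exists (\sum_(i < n) h (a i) (b i)), n, a, b.
- exfalso; apply: (noF F); split=> // a b.
  by apply: FG; exists 1%N, (fun=> a), (fun=> b); rewrite !big_ord1.
Qed.
End TensorProduct.

Arguments tens_continuous_r {R A B} T a _ _ _.
Arguments tens_continuous_l {R A B} T b _ _ _.

(** * Star-homomorphisms and tensor products of maps *)

Section StarHom.
Context {R : realType}.
Implicit Types A B S : unitalCStarType R.

Lemma cstar_continuous A : continuous (cstar : A -> A).
Proof.
move=> x; apply/(@cvgrPdist_lt _ _ _ (nbhs x)) => e e0; near=> y.
by rewrite -cstarB norm_cstar; near: y; apply: cvgr_dist_lt.
Unshelve. all: by end_near. Qed.

Lemma star_hom_id A : unital_star_hom (@id A).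
Proof. by split. Qed.

Lemma star_hom_comp A B S (g : B -> S) (f : A -> B) :
  unital_star_hom g -> unital_star_hom f -> unital_star_hom (g \o f).
Proof.
move=> [gl gm g1 gs] [fl fm f1 fs]; split=> [k x y|x y||x] /=.
- by rewrite fl gl.
- by rewrite fm gm.
- by rewrite f1 g1.
- by rewrite fs gs.
Qed.

Lemma star_representation_comp A B (H : hilbert R) (rho : B -> H -> H)
    (f : A -> B) :
  unital_star_hom f -> star_representation rho ->
  star_representation (fun a => rho (f a)).
Proof.
move=> [fl fm _ fs] [rc rl rm rs]; split=> [a|k a b x|a b x|a x y].
- exact: rc.
- by rewrite fl rl.
- by rewrite fm rm.
- by rewrite rs fs.
Qed.

Lemma star_hom_tens_l A B (T : minTensor A B) :
  unital_star_hom (tens T ^~ cone).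
Proof.
split=> [|x y||x]; first exact: tens_linearl (tensP T) _.
- by rewrite (tensM (tensP T)) cmul1l.
- exact: tens1.
- by rewrite (tens_cstar (tensP T)) cstar1.
Qed.

(** The map [f (x) g] does not increase the minimal norm: composing
    representations with [f] and [g] gives representations, so that the
    supremum defining the norm in the source runs over more pairs than the one
    that arises in the target. *)
Lemma tens_mapP A B A' B' (T : minTensor A B) (T' : minTensor A' B')
    (f : A -> A') (g : B -> B') :
  unital_star_hom f -> unital_star_hom g ->
  [/\ linear (tens_map T T' f g), continuous (tens_map T T' f g)
    & forall a b, tens_map T T' f g (tens T a b) = tens T' (f a) (g b)].
Proof.
move=> hf hg; apply: tens_extP => [b k x y|n a b].
  by case: hf => fl _ _ _; rewrite fl (tens_linearl (tensP T')).
apply/(tens_norm (tensP T') (f \o a) (g \o b) (normr_ge0 _)).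
move=> H K pi rho pirep rhorep.
have /(_ H K (fun x => pi (f x)) (fun y => rho (g y))) :=
  (tens_norm (tensP T) a b (normr_ge0 _)).1 (lexx _).
by apply; exact: star_representation_comp.
Qed.

(** The same with the factors exchanged; the Hilbert spaces of a pair of
    representations are then exchanged as well. *)
Lemma tens_swapP A B A' B' (T : minTensor A B) (T' : minTensor B' A')
    (f : A -> A') (g : B -> B') :
  unital_star_hom f -> unital_star_hom g ->
  let F : T -> T' := tens_ext (fun a b => tens T' (g b) (f a)) in
  [/\ linear F, continuous F
    & forall a b, F (tens T a b) = tens T' (g b) (f a)].
Proof.
move=> hf hg F; apply: tens_extP => [b k x y|n a b].
  by case: hf => fl _ _ _; rewrite fl (tens_linearr (tensP T')).
apply/(tens_norm (tensP T') (g \o b) (f \o a) (normr_ge0 _)).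
move=> H K pi rho pirep rhorep m x y.
rewrite tens_sqnormC [X in _ * X]tens_sqnormC.
have /(_ K H (fun x => rho (f x)) (fun y => pi (g y))) :=
  (tens_norm (tensP T) a b (normr_ge0 _)).1 (lexx _).
by apply; exact: star_representation_comp.
Qed.

(** Products and adjoints in [T] and [S] are continuous, so it suffices that
    [F] respects them on elementary tensors, one factor at a time. *)
Lemma star_hom_tens_ext A B S (T : minTensor A B) (h : A -> B -> S)
    (F : T -> S) :
  linear F -> continuous F -> (forall a b, F (tens T a b) = h a b) ->
  (forall a a' b b', h a b ** h a' b' = h (a ** a') (b ** b')) ->
  h cone cone = cone -> (forall a b, cstar (h a b) = h (cstar a) (cstar b)) ->
  unital_star_hom F.
Proof.
move=> lF cF Fh hM h1 hs.
have contL (k : S) : continuous (fun t => F t ** k).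
  exact: continuous_compose cF (cmul_continuous_l k).
have contR (k : S) : continuous (fun t => k ** F t).
  exact: continuous_compose cF (cmul_continuous_r k).
have contl (u : T) : continuous (fun t => F (t ** u)).
  exact: continuous_compose (cmul_continuous_l u) cF.
have contr (u : T) : continuous (fun t => F (u ** t)).
  exact: continuous_compose (cmul_continuous_r u) cF.
have FM_tens a b t : F (tens T a b ** t) = F (tens T a b) ** F t.
  have : (fun t => F (tens T a b ** t)) = (fun t => F (tens T a b) ** F t).
    apply: elementary_tens_eq => // [k x y|k x y|a' b'].
    - by rewrite cmul_linearr lF.
    - by rewrite lF cmul_linearr.
    - by rewrite (tensM (tensP T)) !Fh hM.
  by move/(congr1 (@^~ t)).
split=> //.
- move=> t u; have : (fun t => F (t ** u)) = (fun t => F t ** F u).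
    apply: elementary_tens_eq => // [k x y|k x y].
    - by rewrite cmul_linearl lF.
    - by rewrite lF cmul_linearl.
  by move/(congr1 (@^~ t)).
- by rewrite -(tens1 T) Fh.
move=> t; have : (fun t => cstar (F (cstar t))) = F.
  have star_lin : linear (fun t => cstar (F (cstar t))).
    by move=> k x y; rewrite cstar_antilinear lF cstar_antilinear conjCK.
  apply: elementary_tens_eq => // [|a b]; last first.
    by rewrite (tens_cstar (tensP T)) !Fh hs !cstarK.
  have cFs := continuous_compose (@cstar_continuous T) cF.
  exact: continuous_compose cFs (@cstar_continuous S).
by move/(congr1 (@^~ t)) => /= <-; rewrite cstarK.
Qed.

End StarHom.

(** * Coassociativity *)

(* Otherwise simplification replaces [tens (mt3l AAA)] by [tens3l AAA]. *)
Local Arguments tens : simpl never.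

Section Flip.
Context {R : realType} {A : unitalCStarType R} (AA : minTensor A A).

Lemma flipP : [/\ linear (flip AA), continuous (flip AA)
  & forall a b, flip AA (tens AA a b) = tens AA b a].
Proof. exact: tens_swapP (@star_hom_id R A) (@star_hom_id R A). Qed.

Lemma star_hom_flip : unital_star_hom (flip AA).
Proof.
have [lin cont fE] := flipP.
apply: (star_hom_tens_ext lin cont fE) => [a a' b b'||a b].
- exact: tensM (tensP AA) _ _ _ _.
- exact: tens1.
- exact: tens_cstar (tensP AA) _ _.
Qed.
End Flip.

Section Coassociativity.
Context {R : realType} {A : unitalCStarType R} {AA : minTensor A A}.
Variable AAA : minTensor3 AA.

Let id_hom : unital_star_hom (@id A) := @star_hom_id R A.
Let T12 := mt3l AAA.
Let T23 := mt3r AAA.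

Let tens3AE a b c : tens T12 (tens AA a b) c = tens T23 a (tens AA b c).
Proof. exact: tens3A. Qed.

(** On elementary tensors, [(Delta (x) id) t] is [W_12 Sigma_12 (1 (x) t)] and
    [(id (x) Delta) t] is [W_23 (t (x) 1)].  Both formulas hold for every [t],
    since both sides are continuous.  At [t = Delta a = W (a (x) 1)] they are
    the two sides of the pentagon equation at [a (x) 1 (x) 1], because [W_23]
    fixes this element ([W] is unital), while [W_13] maps it to
    [Sigma_12 (1 (x) W (a (x) 1))]. *)
Lemma pentagon_coassociative (W : AA -> AA) :
  unital_star_hom W -> pentagon AAA W -> coassociative AAA (W \o DeltaL AA).
Proof.
move=> Whom Wpent.
have Dhom := star_hom_comp Whom (star_hom_tens_l AA).
have [fl fc fE] := flipP AA.
have [lW12 cW12 W12E] := tens_mapP T12 T12 Whom id_hom.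
have [lW23 cW23 W23E] := tens_mapP T23 T23 id_hom Whom.
have [lS12 cS12 S12E] := tens_mapP T12 T12 (star_hom_flip AA) id_hom.
have [lD1 cD1 D1E] := tens_mapP AA T12 Dhom id_hom.
have [lD2 cD2 D2E] := tens_mapP AA T23 id_hom Dhom.
have Dl : tens_map AA T12 (W \o DeltaL AA) id =
    tens_map T12 T12 W id \o tens_map T12 T12 (flip AA) id \o tens T23 cone.
  apply: elementary_tens_eq => // [k x y||a b] /=.
  - by rewrite (tens_linearr (tensP T23)) lS12 lW12.
  - have cWS := continuous_compose cS12 cW12.
    exact: continuous_compose (tens_continuous_r T23 cone) cWS.
  - by rewrite D1E -tens3AE S12E fE W12E.
have Dr : tens_map AA T23 id (W \o DeltaL AA) =
    tens_map T23 T23 id W \o (tens T12 ^~ cone).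
  apply: elementary_tens_eq => // [k x y||a b] /=.
  - by rewrite (tens_linearl (tensP T12)) lW23.
  - exact: continuous_compose (tens_continuous_l T12 _) cW23.
  - by rewrite D2E tens3AE W23E.
rewrite /coassociative Dl Dr; apply/funext => a.
have := congr1 (@^~ (tens T12 (tens AA a cone) cone)) Wpent.
rewrite /leg13 /leg12 /leg23 /= W12E tens3AE W23E tens1.
have [_ _ -> _] := Whom.
by rewrite -(tens1 AA) -tens3AE S12E fE tens3AE W23E.
Qed.

(** Let [Delta'] be the opposite [Sigma Delta].  Reversing the order of three
    tensor factors carries [(id (x) Delta) Delta] to [(Delta' (x) id) Delta']
    and [(Delta (x) id) Delta] to [(id (x) Delta') Delta']. *)
Lemma flip_coassociative (Delta : A -> AA) :
  unital_star_hom Delta -> coassociative AAA Delta ->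
  coassociative AAA (flip AA \o Delta).
Proof.
move=> Dhom Dcoassoc.
have Fhom := star_hom_flip AA; have FDhom := star_hom_comp Fhom Dhom.
have [fl fc fE] := flipP AA.
have [lD1 cD1 D1E] := tens_mapP AA T12 Dhom id_hom.
have [lD2 cD2 D2E] := tens_mapP AA T23 id_hom Dhom.
have [lE1 cE1 E1E] := tens_mapP AA T12 FDhom id_hom.
have [lE2 cE2 E2E] := tens_mapP AA T23 id_hom FDhom.
(* The reversal x (x) y (x) z |-> z (x) y (x) x, defined on A (x) (A (x) A). *)
pose tau : T23 -> T12 := tens_ext (fun a t => tens T12 (flip AA t) a).
have [lt ct tE] : [/\ linear tau, continuous tau &
    forall a t, tau (tens T23 a t) = tens T12 (flip AA t) a].
  exact: tens_swapP.
have tauE b t : tau (tens T12 t b) = tens T23 b (flip AA t).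
  have : tau \o (tens T12 ^~ b) = tens T23 b \o flip AA.
    apply: elementary_tens_eq => [k x y||k x y||x y] /=.
    - by rewrite (tens_linearl (tensP T12)) lt.
    - exact: continuous_compose (tens_continuous_l T12 _) ct.
    - by rewrite fl (tens_linearr (tensP T23)).
    - exact: continuous_compose fc (tens_continuous_r T23 _).
    - by rewrite tens3AE tE !fE tens3AE.
  by move/(congr1 (@^~ t)).
have El : tens_map AA T12 (flip AA \o Delta) id \o flip AA =
    tau \o tens_map AA T23 id Delta.
  apply: elementary_tens_eq => [k x y||k x y||a b] /=.
  - by rewrite fl lE1.
  - exact: continuous_compose fc cE1.
  - by rewrite lD2 lt.
  - exact: continuous_compose cD2 ct.
  - by rewrite fE E1E D2E tE.
have Er : tens_map AA T23 id (flip AA \o Delta) \o flip AA =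
    tau \o tens_map AA T12 Delta id.
  apply: elementary_tens_eq => [k x y||k x y||a b] /=.
  - by rewrite fl lE2.
  - exact: continuous_compose fc cE2.
  - by rewrite lD1 lt.
  - exact: continuous_compose cD1 ct.
  - by rewrite fE E2E D1E tauE.
apply/funext => a; have Ela := congr1 (@^~ (Delta a)) El.
have Era := congr1 (@^~ (Delta a)) Er.
have Da := esym (congr1 (@^~ a) Dcoassoc).
by move: Ela Era => /= -> ->; rewrite [X in tau X]Da.
Qed.

End Coassociativity.

Theorem theorem4p1 (R : realType) (A : unitalCStarType R)
    (AA : minTensor A A) (AAA : minTensor3 AA) (W : AA -> AA)
    (W_hom : unital_star_hom W) (W_pentagon : pentagon AAA W) :
  compact_quantum_semigroup AAA (W \o DeltaL AA) /\
  compact_quantum_semigroup AAA (flip AA \o W \o flip AA \o DeltaR AA).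
Proof.
have Dhom := star_hom_comp W_hom (star_hom_tens_l AA).
have Dcoassoc := pentagon_coassociative W_hom W_pentagon.
have -> : flip AA \o W \o flip AA \o DeltaR AA = flip AA \o (W \o DeltaL AA).
  by have [_ _ fE] := flipP AA; apply/funext => a /=; rewrite fE.
split; split=> //; first exact: star_hom_comp (star_hom_flip AA) Dhom.
exact: flip_coassociative.
Qed.
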